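(* Let $W$ be a random variable with mean zero and finite, nonzero variance $\sigma^2$. Then there exists one and only one probability distribution $\nu$ on $\mathbb{R}$ such that, if $W^*$ has distribution $\nu$, $$E[Wf(W)]=\sigma^2 E[f'(W^* )]$$ for all differentiable $f$ for which $EWf(W)$ exists.
   Context: Random variables are real valued and $f$ denotes a function from $\mathbb{R}$ to $\mathbb{R}$. A variate $W^*$ with this distribution is said to have the $W$-zero biased distribution.
   Formalization: The identity is asserted for differentiable f for which both E[Wf(W)] and E[f'(W* )] exist (as absolutely convergent expectations); existence of E[Wf(W)] alone does not ensure that E[f'(W* )] is defined, e.g. W=±1, f(x)=x^2 sin(1/x^2). *)

(* Defs.v *)
From HB Require Import structures.
From mathcomp Require Import all_boot all_order all_algebra.
From mathcomp Require Import all_classical all_reals all_analysis.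

Set Implicit Arguments.
Unset Strict Implicit.
Unset Printing Implicit Defensive.

Import Order.TTheory GRing.Theory Num.Theory.
Import numFieldNormedType.Exports.

Local Open Scope classical_set_scope.
Local Open Scope ring_scope.

(* A measure is a function on all subsets, whose values outside the
   sigma-algebra are irrelevant: laws are compared on Borel sets only. *)
Definition same_law (R : realType) (mu nu : set R -> \bar R)
    : Prop :=
  forall A : set R, measurable A -> mu A = nu A.

(* "E[X] exists" is read as E|X| < +oo, that is X \in Lfun P 1.  Existence of
   E[f'(W* )] has to be required along with that of E[W f(W)], which does not
   imply it: for W uniform on {-1, 1}, W* is uniform on [-1, 1], and the
   derivative of x^2 sin(1/x^2) (extended by 0) is not Lebesgue integrable
   there. *)
Definition zero_bias_law (R : realType) (d : measure_display)
    (T : measurableType d) (P : probability T R) (W : {RV P >-> R})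
    (sigma : R) (nu : probability R R) : Prop :=
  forall (d' : measure_display) (T' : measurableType d')
      (P' : probability T' R) (Wstar : {RV P' >-> R}),
    same_law (distribution P' Wstar) nu ->
  forall f : R -> R,
    (forall x : R, derivable f x 1) ->
    (fun w => W w * f (W w)) \in Lfun P 1 ->
    (fun w => f^`()%classic (Wstar w)) \in Lfun P' 1 ->
  ('E_P[(fun w => W w * f (W w))%R]
    = (sigma ^+ 2)%:E * 'E_P'[(fun w => f^`()%classic (Wstar w))])%E.

(* Main.v *)
Require Import Defs.
From HB Require Import structures.
From mathcomp Require Import all_boot all_order all_algebra.
From mathcomp Require Import all_classical all_reals all_analysis.
From mathcomp Require Import measurable_realfun.
From mathcomp Require Import ring lra.

Import Order.TTheory GRing.Theory Num.Theory.
Import numFieldNormedType.Exports.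

Local Open Scope classical_set_scope.
Local Open Scope ring_scope.

(** Zero biasing is square biasing followed by uniform contraction.  Draw t from
    P reweighted by the density W^2 / sigma^2, draw u uniformly in the unit
    interval independently, and set W* = u W(t).  Then

      sigma^2 E[f'(W* )] = E[W^2 int_0^1 f'(u W) du]
                         = E[W (f(W) - f(0))] = E[W f(W)],

    where the second equality is the fundamental theorem of calculus on the
    segment from 0 to W and the last one uses E[W] = 0.  The existence of the
    expectation of f'(W* ) is what Fubini's theorem requires, and Fubini's
    theorem returns that f' is Lebesgue integrable on the segment from 0 to
    W(t) for almost every t with W(t) <> 0 ([integral_zero_biased_derive1]).

    Since f' need not be continuous, the fundamental theorem needed is the one
    for a function that is differentiable everywhere and whose derivative is
    Lebesgue integrable ([integral_derivative]).  Its proof compares f with the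
    integral of a majorant g of max(f', 0) which is, near every point c, at
    least max(f'(c), 0), and whose integral exceeds that of max(f', 0) by
    little (Vitali and Caratheodory, [open_majorant]): on every small interval
    around c the increment of f is at most the integral of g up to a small
    error, and such local inequalities add up
    ([straddling_interval_induction]).  Truncating f' from below at -n, and
    then exchanging f and -f, gives the equality.

    For uniqueness, the identity determines the integral of every rescaled
    sigmoid, the derivative of a function of linear growth, against a
    zero-biased law.  Steeper and steeper sigmoids converge pointwise to the
    indicator of an open ray, so two zero-biased laws agree on rays, hence on
    Borel sets ([zero_bias_unique]). *)

(** * Gluing local inequalities on intervals *)

(** Compactness of intervals in the form that suits functions of intervals: the
    supremum of the points x with [G a x] is reached and cannot be less than
    [b].  Small intervals are tested only when they contain the given point c,
    because a derivative at c controls no other increments. *)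
Lemma straddling_interval_induction (R : realType) (G : R -> R -> Prop) (a b : R) :
  a <= b ->
  (forall x y z, x <= y -> y <= z -> G x y -> G y z -> G x z) ->
  (forall c, a <= c <= b -> exists2 e, 0 < e & forall x y,
     a <= x -> y <= b -> c - e < x -> x <= c -> c <= y -> y < c + e -> G x y) ->
  G a b.
Proof.
move=> ab G_cat G_loc.
pose S := [set x | a <= x <= b /\ G a x].
have Sa : S a.
  split; first by rewrite lexx ab.
  have /G_loc[e e0] : a <= a <= b by rewrite lexx ab.
  by apply; rewrite ?lexx ?gtrBl ?ltrDl.
have supS : has_sup S by split; [exists a|exists b => x [/andP[]]].
set s := sup S.
have as_ : a <= s by exact: ub_le_sup supS.2 _ Sa.
have sb : s <= b by apply: ge_sup; [exists a|move=> x [/andP[]]].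
have /G_loc[e e0 Gs] : a <= s <= b by rewrite as_ sb.
have [x [/andP[ax xb] Gax] xs] := sup_adherent e0 supS.
have xles : x <= s by apply: ub_le_sup; [exact: supS.2|split=> //; rewrite ax].
(* A point beyond s, unless s is b. *)
pose y := Num.min b (s + e / 2).
have sy : s <= y by rewrite le_min sb lerDl divr_ge0// ltW.
have yb : y <= b by rewrite ge_min lexx.
have yse : y < s + e by rewrite gt_min ltrD2l ltr_pdivrMr// ltr_pMr// ltr1n orbT.
have Gay : G a y by apply: (G_cat _ x) => //; [exact: le_trans sy|exact: Gs].
suff <- : y = b by [].
apply/eqP; rewrite eq_le yb /= leNgt; apply/negP => yltb.
have ys : y <= s.
  by apply: ub_le_sup; [exact: supS.2|split=> //; rewrite yb (le_trans as_)].
move: ys; rewrite leNgt => /negP; apply; rewrite lt_min.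
move: yltb; rewrite gt_min ltxx/= => seb.
rewrite ltrDl divr_gt0// andbT; apply: le_lt_trans seb.
by rewrite lerDl divr_ge0// ltW.
Qed.

(** * Majorants that are locally bounded below by a given function *)

Section layers.
Context {R : realType} (h : R) (h_gt0 : 0 < h).
Local Open Scope ereal_scope.

(** Cutting a value v into layers of height h gives the sum of h over the n with
    n h < v, which is v rounded up to a multiple of h. *)
Lemma layers_le (v : R) : (0 <= v)%R ->
  \sum_(n <oo) (h * ((n%:R * h < v)%R : nat)%:R)%:E <= (v + h)%:E.
Proof.
move=> v0; apply: lime_le => /=.
  by apply: is_cvg_nneseries => n _ _; rewrite lee_fin mulr_ge0// ltW.
apply: nearW => N; rewrite big_mkord sumEFin lee_fin.
(* The first bound serves the induction: a layer N is counted when N h < v. *)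
suff : ((\sum_(i < N) h * ((i%:R * h < v)%R : nat)%:R <= N%:R * h) /\
  (\sum_(i < N) h * ((i%:R * h < v)%R : nat)%:R <= v + h))%R by case.
elim: N => [|N [IH1 IH2]].
  by rewrite big_ord0 mul0r lexx addr_ge0// ltW.
rewrite big_ord_recr/= -natr1 mulrDl mul1r.
case: ltP => [Nv|_]; rewrite ?mulr1 ?mulr0 ?addr0.
  by split; rewrite lerD// (le_trans IH1)// ltW.
by split=> //; rewrite (le_trans IH1)// lerDl ltW.
Qed.

Lemma le_layers (U : (set R)^nat) (v : R) (N : nat) (t : R) :
  (v <= N%:R * h)%R -> (forall n, (n < N)%N -> U n t) ->
  v%:E <= \sum_(n <oo) (h * \1_(U n) t)%:E.
Proof.
move=> vN Ut; rewrite (@nneseries_split _ _ 0 N); last first.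
  by move=> n _; rewrite lee_fin mulr_ge0// ltW.
rewrite add0n; apply: le_trans (leeDl _ _); last first.
  by apply: nneseries_ge0 => n _ _; rewrite lee_fin mulr_ge0// ltW.
rewrite big_mkord sumEFin lee_fin (le_trans vN)//.
rewrite (eq_bigr (fun=> h)); last first.
  by move=> i _; rewrite indicE mem_set ?mulr1//; exact: Ut.
by rewrite sumr_const card_ord mulr_natl.
Qed.

End layers.

Section majorant.
Context {R : realType}.
Notation mu := (@lebesgue_measure R).
Local Open Scope ereal_scope.

(** A measurable function is the sum of h times the indicators of its superlevel
    sets S n = {u > n h}, up to an error h.  Replacing S n by an open set U n
    that contains it increases the integral by as little as wanted.  A point c
    lies in the finitely many S n with n h < u c; the corresponding U n all
    contain a neighbourhood of c, on which the new sum is therefore at least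
    u c. *)
Lemma open_majorant (D : set R) (u : R -> R) (e : R) :
  measurable D -> mu D < +oo -> measurable_fun D u ->
  (forall x, 0 <= u x)%R -> (0 < e)%R ->
  exists g : R -> \bar R, [/\ measurable_fun setT g, (forall x, 0 <= g x),
    \int[mu]_(x in D) g x <= \int[mu]_(x in D) (u x)%:E + e%:E &
    forall c, D c -> \forall t \near c, (u c)%:E <= g t].
Proof.
move=> mD Doo mu_ u0 e0.
have Dfin : mu D \is a fin_num by rewrite ge0_fin_numE.
have D0 : (0 <= fine (mu D))%R by rewrite fine_ge0.
(* Half of e pays for rounding u up to a multiple of h on D. *)
have [h h0 hD] : exists2 h, (0 < h)%R & (h * fine (mu D) <= e / 2)%R.
  have D1 : (0 < fine (mu D) + 1)%R by rewrite ltr_wpDl.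
  exists (e / 2 / (fine (mu D) + 1))%R; first by apply: divr_gt0 => //; apply: divr_gt0.
  by rewrite mulrAC ler_pdivrMr// ler_pM2l ?divr_gt0// lerDl.
pose S n := D `&` [set x | (n%:R * h < u x)%R].
have mS n : measurable (S n).
  have -> : S n = D `&` u @^-1` `](n%:R * h)%R, +oo[.
    by apply/seteqP; split => x [Dx]; rewrite /= in_itv/= andbT.
  by apply: mu_ => //; exact: measurable_itv.
(* The other half pays for the open sets: h r n sums to at most e / 2. *)
have [r r0 rE] : exists2 r : R^nat, (forall n, 0 < r n)%R &
    forall n, (h * r n = e / 2 / (2 ^ n.+1)%:R)%R.
  have p0 n : (0 < (2 ^ n.+1)%:R :> R)%R by rewrite ltr0n expn_gt0.
  exists (fun n => e / 2 / (2 ^ n.+1)%:R / h)%R => n.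
    by apply: divr_gt0 => //; apply: divr_gt0 => //; apply: divr_gt0.
  by rewrite mulrC mulfVK// gt_eqF.
have Uex n : exists U : set R, [/\ open U, S n `<=` U & mu (U `\` S n) < (r n)%:E].
  apply: lebesgue_regularity_outer => //.
  apply: le_lt_trans Doo; apply: le_measure; rewrite ?inE.
  - exact: mS.
  - exact: mD.
  - by move=> x [].
pose U n := sval (cid (Uex n)).
have oU n : open (U n) by rewrite /U; case: cid => ? [].
have SU n : S n `<=` U n by rewrite /U; case: cid => ? [].
have US n : mu (U n `\` S n) < (r n)%:E by rewrite /U; case: cid => ? [].
have mU n : measurable (U n) by exact: open_measurable.
have m1 (A : set R) : measurable A ->
    measurable_fun setT (fun x => (h * \1_A x)%:E).
  move=> mA; apply/measurable_EFinP.
  by apply: measurable_funM => //; exact: measurable_indic.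
have p1 (A : set R) x : 0 <= (h * \1_A x)%:E.
  by rewrite lee_fin mulr_ge0// ltW.
have i1 (A : set R) : measurable A ->
    \int[mu]_(x in D) (h * \1_A x)%:E = h%:E * mu (A `&` D).
  move=> mA; under eq_integral do rewrite EFinM.
  rewrite ge0_integralZl//; first by rewrite integral_indic.
  - by apply/measurable_EFinP; exact: measurable_indic.
  - by rewrite lee_fin ltW.
have mser (A : (set R)^nat) : (forall n, measurable (A n)) ->
    measurable_fun setT (fun x => \sum_(n <oo) (h * \1_(A n) x)%:E).
  move=> mA; apply: (@ge0_emeasurable_sum _ _ R setT
    (fun n x => (h * \1_(A n) x)%:E) xpredT) => [n x _ _|n _]; first exact: p1.
  exact: m1.
have Sle (x : R) : D x -> \sum_(n <oo) (h * \1_(S n) x)%:E <= (u x + h)%:E.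
  move=> Dx; apply: le_trans (layers_le _ h0 _ (u0 x)).
  apply: lee_nneseries => [n _ _|n _]; first exact: p1.
  rewrite lee_fin ler_pM2l// indicE; case: ltP => hu; first by case: (_ \in _).
  by rewrite memNset//= => -[_] /=; rewrite ltNge hu.
exists (fun x => \sum_(n <oo) (h * \1_(U n) x)%:E); split.
- exact: mser.
- by move=> x; apply: nneseries_ge0.
- rewrite integral_nneseries//; last by move=> n; apply: measurable_funTS; exact: m1.
  apply: (@le_trans _ _ (\sum_(n <oo) (h%:E * mu (S n) + (h * r n)%:E))).
    apply: lee_nneseries => [n _ _|n _]; first exact: integral_ge0.
    rewrite i1// EFinM -muleDr// ?ge0_adde_def ?inE ?lee_fin// ?(ltW (r0 _))//.
    rewrite lee_pmul2l//.
    have mUS : measurable (U n `\` S n) by exact: measurableD.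
    have mUSD : measurable ((U n `\` S n) `&` D) by exact: measurableI.
    have -> : U n `&` D = S n `|` ((U n `\` S n) `&` D).
      apply/seteqP; split => x /=.
        by move=> [Ux Dx]; have [Sx|Sx] := pselect (S n x); [left|right].
      by move=> [Sx|[[Ux _] Dx]//]; split; [exact: SU|case: Sx].
    apply: (@le_trans _ _ (mu (S n) + mu ((U n `\` S n) `&` D))).
      by apply: measureU2; [exact: mS|exact: mUSD].
    rewrite leeD2l//; apply: le_trans (ltW (US n)).
    by apply: le_measure; rewrite ?inE//; exact: subIsetl.
  rewrite nneseriesD//; last 2 first.
    by move=> n _; rewrite mule_ge0// lee_fin ltW.
    by move=> n _; rewrite lee_fin mulr_ge0// ltW.
  apply: (@le_trans _ _ (\int[mu]_(x in D) (u x + h)%:E + (e / 2)%:E)).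
    apply: leeD.
      rewrite (_ : \sum_(n <oo) _ =
          \int[mu]_(x in D) \sum_(n <oo) (h * \1_(S n) x)%:E); last first.
        rewrite integral_nneseries//; last first.
          by move=> n; apply: measurable_funTS; exact: m1.
        by apply: eq_eseriesr => n _; rewrite i1// setIAC setIid.
      apply: ge0_le_integral => //.
      - by move=> x _; apply: nneseries_ge0.
      - by apply: measurable_funTS; exact: mser.
      - by apply/measurable_EFinP; apply: measurable_funD.
    rewrite (eq_eseriesr (fun n _ => congr1 EFin (rE n))).
    by apply: epsilon_trick0 => //; rewrite divr_ge0// ltW.
  rewrite (_ : \int[mu]_(x in D) (u x + h)%:E =
      \int[mu]_(x in D) (u x)%:E + h%:E * mu D); last first.
    under eq_integral do rewrite EFinD.
    rewrite ge0_integralD//=.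
    - by rewrite integral_cst.
    - by move=> x _; rewrite lee_fin.
    - exact/measurable_EFinP.
    - by move=> x _; rewrite lee_fin ltW.
  rewrite -addeA leeD2l// -(fineK Dfin) -EFinM -EFinD lee_fin.
  by rewrite [leRHS](splitr e) lerD2r.
- move=> c Dc.
  have exN : exists N : nat, (u c <= N%:R * h)%R.
    exists (Num.bound (u c / h)); rewrite -ler_pdivrMr//.
    by apply: ltW; apply: le_lt_trans (archi_boundP _); rewrite ?divr_ge0// ltW.
  pose N := ex_minn exN.
  have [cN Nmin] : (u c <= N%:R * h)%R /\ forall n, (u c <= n%:R * h)%R -> (N <= n)%N.
    by rewrite /N; case: ex_minnP.
  have Unear n : (n < N)%N -> \forall t \near c, U n t.
    move=> nN; apply: open_nbhs_nbhs; split; first exact: oU.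
    apply: SU; split => //=; rewrite ltNge; apply/negP => /Nmin.
    by rewrite leqNgt nN.
  have : \forall t \near c, forall i : 'I_N, U i t.
    have F : Filter (nbhs c) by exact: nbhs_filter.
    exact: (@filter_forall R 'I_N (fun i => U i) (nbhs c) F
      (fun i => Unear i (ltn_ord i))).
  apply: filterS => t Ut; apply: (@le_layers _ h h0 U (u c) N t) => // n nN.
  exact: (Ut (Ordinal nN)).
Qed.

End majorant.

(** * The fundamental theorem for everywhere differentiable functions *)

Section ftc_everywhere_differentiable.
Context {R : realType}.
Notation mu := (@lebesgue_measure R).

Lemma lebesgue_measure_bounded_itv (a b : R) (b0 b1 : bool) : a <= b ->
  mu [set` Interval (BSide b0 a) (BSide b1 b)] = (b - a)%:E.
Proof.
move=> ab; rewrite lebesgue_measure_itv/= lte_fin; case: ltP => // ba.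
by rewrite (@le_anti _ _ a b) ?ab// subrr.
Qed.

(** Splitting the increment at c, both halves are controlled by the difference
    quotients at c; intervals that do not contain c are not. *)
Lemma increment_le_straddling (f : R -> R) (c l e : R) :
  is_derive c 1 f l -> 0 < e ->
  exists2 r, 0 < r & forall x y, c - r < x -> x <= c -> c <= y -> y < c + r ->
    f y - f x <= (l + e) * (y - x).
Proof.
move=> [dfc <-] e0.
have /cvgrPdist_le/(_ e e0)/nbhs_ballP[r/= r0 rP] :
  (fun h => h^-1 *: ((f \o shift c) (h *: 1) - f c)) @ 0^' --> 'D_1 f c by [].
exists r => // x y crx xc cy ycr.
have near_c z : `|z - c| < r -> `|f z - f c - 'D_1 f c * (z - c)| <= e * `|z - c|.
  move=> zr; have [->|zc] := eqVneq z c; first by rewrite !subrr mulr0 subr0 normr0 mulr0.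
  have zc0 : z - c != 0 by rewrite subr_eq0.
  have := rP (z - c); rewrite /ball/= sub0r normrN => /(_ zr zc0).
  rewrite /shift/= [_ *: 1]mulr1 subrK distrC -(ler_pM2r (_ : 0 < `|z - c|)) ?normr_gt0//.
  by rewrite -normrM mulrBl /GRing.scale/= [_ * (f z - f c)]mulrC mulfVK.
have := near_c x; rewrite ler0_norm ?subr_le0// => /(_ _)/ler_normlP[|A _].
  by rewrite opprB ltrBlDr -ltrBlDl.
have := near_c y; rewrite ger0_norm ?subr_ge0// => /(_ _)/ler_normlP[|_ B].
  by rewrite ltrBlDl.
nra.
Qed.

(** On a small interval around c the increment of f is at most max(d c, 0) plus a
    small slope, times the length; the majorant of [open_majorant] turns this
    bound into an integral. *)
Lemma increment_le_integral_pos (f d : R -> R) (a b : R) : a <= b ->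
  (forall x, a <= x <= b -> is_derive x 1 f (d x)) ->
  measurable_fun `[a, b] d ->
  ((f b - f a)%:E <= \int[mu]_(x in `[a, b]) (Num.max (d x) 0)%:E)%E.
Proof.
move=> ab fd md; apply/lee_addgt0Pr => e e0.
pose u x := Num.max (d x) 0.
have mab : mu `[a, b] = (b - a)%:E by exact: lebesgue_measure_bounded_itv.
(* Half of e is spent on the majorant, half on the slope e2. *)
have [||||g [mg g0 gu gnear]] := @open_majorant R `[a, b] u (e / 2) (measurable_itv _).
- by rewrite mab ltry.
- exact: measurable_maxr.
- by move=> x; rewrite le_max lexx orbT.
- exact: divr_gt0.
have [e2 e20 e2ab] : exists2 e2, 0 < e2 & e2 * (b - a) <= e / 2.
  have ba1 : 0 < b - a + 1 by rewrite ltr_wpDl// subr_ge0.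
  exists (e / 2 / (b - a + 1)); first by apply: divr_gt0 => //; exact: divr_gt0.
  by rewrite mulrAC ler_pdivrMr// ler_pM2l ?divr_gt0// lerDl.
(* Half-open intervals make the integral exactly additive in G. *)
pose G x y := ((f y - f x - e2 * (y - x))%:E <= \int[mu]_(t in `]x, y]) g t)%E.
have : G a b.
  apply: (@straddling_interval_induction R G a b ab).
    move=> x y z xy yz Gxy Gyz; rewrite /G.
    rewrite (@itv_bndbnd_setU _ _ _ (BRight y))// ge0_integral_setU//=; last 2 first.
    - exact: measurable_funTS.
    - apply/disj_setPS => t [] /=; rewrite !in_itv/= => /andP[_ ty] /andP[+ _].
      by rewrite ltNge ty.
    apply: le_trans (leeD Gxy Gyz); rewrite -EFinD lee_fin.
    by rewrite le_eqVlt; apply/orP; left; apply/eqP; ring.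
  move=> c cab; have [r1 r10 fr1] := increment_le_straddling _ _ _ _ (fd c cab) e20.
  have [r2 /= r20 gr2] : \forall t \near c, ((u c)%:E <= g t)%E.
    by apply: gnear; rewrite /= in_itv.
  exists (Num.min r1 r2); first by rewrite lt_min r10.
  move=> x y ax yb; rewrite !ltrBlDr -!ltrBlDl !lt_min.
  move=> /andP[cx1 cx2] xc cy /andP[cy1 cy2].
  apply: (@le_trans _ _ (u c * (y - x))%:E).
    rewrite lee_fin lerBlDr -mulrDl; apply: le_trans (fr1 _ _ _ _ _ _) _ => //; try lra.
    rewrite ler_wpM2r ?subr_ge0 ?(le_trans xc)// lerD2r /u le_max lexx//.
  have mxy : mu `]x, y] = (y - x)%:E.
    by apply: lebesgue_measure_bounded_itv; exact: le_trans xc cy.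
  rewrite EFinM -mxy -integral_cst//; apply: ge0_le_integral => //.
  - by move=> t _; rewrite lee_fin le_max lexx orbT.
  - exact: measurable_funTS.
  - move=> t; rewrite /= in_itv/= => /andP[xt ty]; apply: gr2.
    rewrite /ball/= ltr_distl; apply/andP; split; lra.
rewrite /G => Gab.
have : ((f b - f a)%:E <= \int[mu]_(t in `]a, b]) g t + (e / 2)%:E)%E.
  apply: le_trans (leeD2r _ Gab); rewrite -EFinD lee_fin; lra.
move=> /le_trans; apply.
rewrite [e in leRHS]splitr EFinD addeA leeD2r//.
apply: le_trans gu; apply: ge0_subset_integral => //.
- exact: measurable_funTS.
- by move=> t /=; rewrite !in_itv/= => /andP[/ltW -> ->].
Qed.

(** Adding n x to f turns the positive part of the derivative into the truncation
    of d at -n, up to the constant n; the truncations converge to d and are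
    dominated by |d|. *)
Lemma increment_le_integral (f d : R -> R) (a b : R) : a <= b ->
  (forall x, a <= x <= b -> is_derive x 1 f (d x)) ->
  mu.-integrable `[a, b] (EFin \o d) ->
  ((f b - f a)%:E <= \int[mu]_(x in `[a, b]) (d x)%:E)%E.
Proof.
move=> ab fd di.
have md : measurable_fun `[a, b] d.
  by apply/measurable_EFinP; exact: measurable_int di.
pose t n x := Num.max (d x) (- n%:R).
have mt n : measurable_fun `[a, b] (t n) by exact: measurable_maxr.
have t_d n x : `|t n x| <= `|d x|.
  rewrite /t maxEle; case: ifPn => [dn|//].
  have d0 : d x <= 0 by rewrite (le_trans dn)// oppr_le0.
  by rewrite normrN ger0_norm ?ler0n// ler0_norm// lerNr.
have it n : mu.-integrable `[a, b] (EFin \o t n).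
  apply: le_integrable di => //; first by apply/measurable_EFinP; exact: mt.
  by move=> x _ /=; rewrite lee_fin.
have mab : mu `[a, b] = (b - a)%:E by exact: lebesgue_measure_bounded_itv.
have le_t n : ((f b - f a)%:E <= \int[mu]_(x in `[a, b]) (t n x)%:E)%E.
  have fd' x : a <= x <= b -> is_derive x 1 (fun x => f x + n%:R * x) (d x + n%:R).
    move=> /fd dx; have -> : d x + n%:R = d x + n%:R *: (1 : R).
      by rewrite /GRing.scale/= mulr1.
    by apply: (@is_deriveD R R R f (n%:R \*: id)); exact: is_deriveZ.
  have md' : measurable_fun `[a, b] (fun x => d x + n%:R).
    by apply: measurable_funD => //; exact: measurable_cst.
  have := increment_le_integral_pos _ _ _ _ ab fd' md'.
  have te x : Num.max (d x + n%:R) 0 = t n x + n%:R by rewrite addr_maxl addNr.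
  under eq_integral do rewrite te EFinD.
  rewrite integralD//; [|exact: it|]; last first.
    apply/integrableP; split => //.
    by rewrite integral_cst//= mab -EFinM ltry.
  rewrite integral_cst//= mab -EFinM -leeBlDr// -EFinB.
  apply: le_trans; rewrite lee_fin.
  by rewrite le_eqVlt; apply/orP; left; apply/eqP; ring.
have cvt : (\int[mu]_(x in `[a, b]) (t n x)%:E)%E @[n --> \oo] -->
    (\int[mu]_(x in `[a, b]) (d x)%:E)%E.
  apply: (@dominated_cvg _ _ R mu _ (measurable_itv _) _ _ (fun x => `|d x|%:E)) => //.
  - by move=> n; apply/measurable_EFinP; exact: mt.
  - move=> x _; apply: cvg_near_cst; apply: filterS (nbhs_infty_ger (- d x)) => n.
    by rewrite lerNl /t => /max_l ->.
  - exact: integrable_norm.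
  - by move=> n x _; rewrite lee_fin.
rewrite -(cvg_lim _ cvt)//; apply: lime_ge; first by apply/cvg_ex; eexists; exact: cvt.
exact: nearW.
Qed.

(** The inequality for f and for -f. *)
Lemma integral_derivative (f d : R -> R) (a b : R) : a <= b ->
  (forall x, a <= x <= b -> is_derive x 1 f (d x)) ->
  mu.-integrable `[a, b] (EFin \o d) ->
  (\int[mu]_(x in `[a, b]) (d x)%:E = (f b - f a)%:E)%E.
Proof.
move=> ab fd di; apply/eqP; rewrite eq_le increment_le_integral// andbT.
have fdN x : a <= x <= b -> is_derive x 1 (- f) (- d x) by move=> /fd; exact: is_deriveN.
have diN : mu.-integrable `[a, b] (EFin \o (fun x => - d x)).
  by rewrite (_ : _ \o _ = (fun x => - (d x)%:E)%E)//; exact: integrableN.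
have := increment_le_integral _ _ _ _ ab fdN diN.
under eq_integral do rewrite EFinN.
rewrite integralN/=; last by rewrite integrable_add_def.
by rewrite leeNr -EFinN opprB opprK addrC.
Qed.

End ftc_everywhere_differentiable.

(** * The law of a map under a measure with a density *)

Section weighted_law.
Context d d' (S : measurableType d) (T : measurableType d') (R : realType).
Variables (m : {measure set S -> \bar R}) (X : S -> T) (g : S -> R).
Local Open Scope ereal_scope.

(** The law of X under the measure with density g with respect to m.  The proofs
    are arguments of the function so that it carries a structure of
    probability. *)
Definition weighted_law (mX : measurable_fun setT X) (mg : measurable_fun setT g)
    (g_ge0 : forall s, (0 <= g s)%R) (g1 : \int[m]_s (g s)%:E = 1) : set T -> \bar R :=
  fun A => \int[m]_(s in X @^-1` A) (g s)%:E.

Hypothesis mX : measurable_fun setT X.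
Hypothesis mg : measurable_fun setT g.
Hypothesis g_ge0 : forall s, (0 <= g s)%R.
Hypothesis g1 : \int[m]_s (g s)%:E = 1.
Let nu := weighted_law mX mg g_ge0 g1.

Let mpre A : measurable A -> measurable (X @^-1` A).
Proof. by move=> mA; rewrite -[X in measurable X]setTI; exact: mX. Qed.

Let mEg : measurable_fun setT (EFin \o g). Proof. exact/measurable_EFinP. Qed.

Let nu0 : nu set0 = 0.
Proof. by rewrite /nu /weighted_law preimage_set0 integral_set0. Qed.

Let nu_ge0 A : 0 <= nu A.
Proof. by apply: integral_ge0 => s _; rewrite lee_fin. Qed.

Let nu_sigma_additive : semi_sigma_additive nu.
Proof.
move=> /= F mF tF mUF; rewrite /nu /weighted_law; apply: cvg_toP.
  apply: ereal_nondecreasing_is_cvgn => i j ij.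
  by apply: lee_sum_nneg_natr => // k _ _; exact: nu_ge0.
rewrite preimage_bigcup ge0_integral_bigcup//=.
- by move=> i; exact: mpre.
- exact: measurable_funTS.
- by move=> s _; rewrite lee_fin.
- apply/trivIsetP => i j _ _ ij.
  by rewrite -preimage_setI (trivIsetP.1 tF)// preimage_set0.
Qed.

HB.instance Definition _ := isMeasure.Build _ _ _
  (weighted_law mX mg g_ge0 g1) nu0 nu_ge0 nu_sigma_additive.

Let nu_setT : nu setT = 1.
Proof. by rewrite /nu /weighted_law preimage_setT. Qed.

HB.instance Definition _ := @Measure_isProbability.Build _ _ R
  (weighted_law mX mg g_ge0 g1) nu_setT.

Let indic_case E : measurable E ->
  \int[nu]_y (\1_E y)%:E = \int[m]_s ((\1_E (X s))%:E * (g s)%:E).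
Proof.
move=> mE; rewrite integral_indic// setIT [LHS]/= [LHS]integral_mkcond.
apply: eq_integral => s _; rewrite patchE indicE.
rewrite (_ : (s \in X @^-1` E) = (X s \in E)).
  by case: ifPn => _; rewrite ?mul1e ?mul0e.
by apply/idP/idP => /[!inE].
Qed.

Import HBNNSimple.

Let nnsfun_case (f : {nnsfun T >-> R}) :
  \int[nu]_y (f y)%:E = \int[m]_s ((f (X s))%:E * (g s)%:E).
Proof.
under [LHS]eq_integral do rewrite fimfunE -fsumEFin//.
rewrite [LHS]ge0_integral_fsum//; last 2 first.
  - by move=> r; exact/measurable_EFinP/measurableT_comp.
  - by move=> n x _; rewrite EFinM nnfun_muleindic_ge0.
under [RHS]eq_integral.
  move=> s _; rewrite fimfunE -fsumEFin// ge0_mule_fsuml; last first.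
    by move=> r; rewrite EFinM nnfun_muleindic_ge0.
  over.
rewrite [RHS]ge0_integral_fsum//; last 2 first.
  - move=> r; apply: emeasurable_funM => //; apply/measurable_EFinP.
    by apply: measurable_funM => //; apply: measurableT_comp mX; exact: measurable_indic.
  - by move=> n x _; rewrite mule_ge0// ?lee_fin//; exact: nnfun_muleindic_ge0.
apply: eq_fsbigr => r /[!inE] -[t _ <-].
rewrite integralZl_indic_nnsfun//= indic_case// -ge0_integralZl//.
- by apply: eq_integral => s _; rewrite EFinM muleA.
- apply: emeasurable_funM => //; apply/measurable_EFinP.
  by apply: measurableT_comp mX; exact: measurable_indic.
- by move=> s _; rewrite mule_ge0// lee_fin.
- by rewrite lee_fin.
Qed.

Lemma ge0_integral_weighted_law (f : T -> \bar R) :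
  measurable_fun setT f -> (forall y, 0 <= f y) ->
  \int[weighted_law mX mg g_ge0 g1]_y f y = \int[m]_s (f (X s) * (g s)%:E).
Proof.
move=> mf f0.
pose f_ := nnsfun_approx measurableT mf.
transitivity (lim (\int[nu]_y (f_ n y)%:E @[n --> \oo])).
  rewrite -monotone_convergence//=.
  - apply: eq_integral => y /[!inE] yD; apply/esym/cvg_lim => //=.
    exact: cvg_nnsfun_approx.
  - by move=> n; exact/measurable_EFinP/measurable_funTS.
  - by move=> n ? _; rewrite lee_fin.
  - by move=> ? _ ? ? mn; rewrite lee_fin; exact/lefP/nd_nnsfun_approx.
rewrite [RHS](_ : _ = lim (\int[m]_s ((f_ n (X s))%:E * (g s)%:E) @[n --> \oo])).
  by apply: congr_lim; apply/funext => n /=; exact: nnsfun_case.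
rewrite -monotone_convergence//=.
- apply: eq_integral => s _; apply/esym/cvg_lim => //.
  by apply: cvgeZr => //; exact: cvg_nnsfun_approx.
- move=> n; apply: emeasurable_funM => //; apply/measurable_EFinP.
  exact: measurableT_comp.
- by move=> n s _; rewrite mule_ge0// lee_fin.
- move=> s _ i j ij; rewrite lee_wpmul2r ?lee_fin//; exact/lefP/nd_nnsfun_approx.
Qed.

(** Multiplication by g, which is nonnegative, commutes with taking positive and
    negative parts. *)
Lemma integral_weighted_law (f : T -> \bar R) : measurable_fun setT f ->
  \int[weighted_law mX mg g_ge0 g1]_y f y = \int[m]_s (f (X s) * (g s)%:E).
Proof.
move=> mf; rewrite [LHS]integralE [RHS]integralE.
rewrite ge0_integral_weighted_law//; last exact: measurable_funepos.
rewrite ge0_integral_weighted_law//; last exact: measurable_funeneg.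
congr (_ - _); apply: eq_integral => s _.
  have := congr1 (fun h => h s) (ge0_funeposM (f \o X) (g_ge0 s)).
  by rewrite !funeposE /= => E; rewrite muleC -E muleC.
have := congr1 (fun h => h s) (ge0_funenegM (f \o X) (g_ge0 s)).
by rewrite !funenegE /= => E; rewrite muleC -E muleC.
Qed.

End weighted_law.
Arguments weighted_law {d d' S T R m X g} mX mg g_ge0 g1.

(** * Derivatives along segments from the origin *)

Section derivative_on_segments.
Context {R : realType}.
Notation mu := (@lebesgue_measure R).

Lemma derivable_measurable (f : R -> R) :
  (forall x, derivable f x 1) -> measurable_fun setT f.
Proof.
move=> df; apply: continuous_measurable_fun => x.
exact/differentiable_continuous/derivable1_diffP.
Qed.

(** A derivative is a pointwise limit of difference quotients with step 1/(n+1). *)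
Lemma measurable_derive1 (f : R -> R) :
  (forall x, derivable f x 1) -> measurable_fun setT f^`()%classic.
Proof.
move=> df.
pose q (n : nat) (x : R) := n.+1%:R * (f (x + n.+1%:R^-1) - f x).
apply: (@measurable_fun_cvg _ _ R setT q) => [n|x _].
  apply: measurable_funM => //; apply: measurable_funB.
    apply: (measurableT_comp (derivable_measurable f df)).
    by apply: measurable_funD => //; exact: measurable_cst.
  exact: derivable_measurable.
have dfx : (fun h => h^-1 *: ((f \o shift x) (h *: 1) - f x)) @ 0^' --> f^`()%classic x.
  by rewrite derive1E; exact: df.
have := (cvgr_dnbhsP _ _ _).1 dfx harmonic.
have h0 (n : nat) : @harmonic R n != 0 by rewrite invr_eq0.
move=> /(_ (conj h0 (@cvg_harmonic R))); apply: cvg_trans; apply: near_eq_cvg.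
apply: nearW => n; rewrite /q /harmonic/= invrK /shift/= [_ *: 1]mulr1 [RHS]/(_ *: _).
by rewrite [_ + x]addrC.
Qed.

Lemma integral_derive1_dilation (f : R -> R) (w : R) : (forall x, derivable f x 1) ->
  mu.-integrable `[0, 1] (fun u => (w * f^`()%classic (u * w))%:E) ->
  (\int[mu]_(u in `[0%R, 1%R]) (w * f^`()%classic (u * w))%:E = (f w - f 0)%:E)%E.
Proof.
move=> df ifw.
have dfw (u : R) : 0 <= u <= 1 ->
    is_derive u 1 (fun u : R => f (u * w)) (w * f^`()%classic (u * w)).
  move=> _; rewrite mulrC; apply: (@is_derive1_comp _ f (fun u => u * w)).
    by rewrite derive1E; exact: derivableP.
  have := @is_deriveZ R R R id w u 1 1 (is_derive_id u 1).
  rewrite [w *: 1]mulr1 (_ : w \*: id = (fun u => u * w))//.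
  by apply/funext => v; rewrite mulrC.
by have := integral_derivative _ _ _ _ ler01 dfw ifw; rewrite mul1r mul0r.
Qed.

(** The inner integral that Fubini's theorem produces.  When w is not 0 the
    integrability assumption gives back that of u |-> w f'(u w) on the unit
    interval; when w is 0 both sides vanish. *)
Lemma integral_derive1_dilation_unit_interval (f : R -> R) (w k : R) : k != 0 ->
  (forall x, derivable f x 1) ->
  mu.-integrable setT
    (fun u => (f^`()%classic (u * w) * (k * w ^+ 2 * \1_(`[0, 1]) u))%:E) ->
  (\int[mu]_u (f^`()%classic (u * w) * (k * w ^+ 2 * \1_(`[0, 1]) u))%:E
    = (k * (w * (f w - f 0)))%:E)%E.
Proof.
move=> k0 df ifw.
have [->|w0] := eqVneq w 0.
  rewrite subrr mulr0 mulr0 integral0_eq// => u _.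
  by rewrite expr0n/= !mulr0 mul0r mulr0.
have patchE_ (u : R) : ((f^`()%classic (u * w) * (k * w ^+ 2 * \1_(`[0, 1]) u))%:E
    = ((fun u => (k * w)%:E * (w * f^`()%classic (u * w))%:E) \_ `[0%R, 1%R]) u)%E.
  rewrite patchE indicE; case: ifPn => _; last by rewrite !mulr0.
  by rewrite -EFinM mulr1; congr EFin; ring.
have {}ifw : mu.-integrable `[0, 1]
    (fun u => (k * w)%:E * (w * f^`()%classic (u * w))%:E)%E.
  apply/integrable_mkcond; first exact: measurable_itv.
  by apply: eq_integrable ifw => // u _; exact: patchE_.
under eq_integral do rewrite patchE_.
rewrite -integral_mkcond.
have iw : mu.-integrable `[0, 1] (fun u => (w * f^`()%classic (u * w))%:E).
  have := (fun mI => integrableZl mI (k * w)^-1 ifw) (measurable_itv _).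
  apply: eq_integrable => // u _; by rewrite muleA -!EFinM mulVf ?mul1r ?mulf_neq0.
rewrite integralZl// integral_derive1_dilation// -EFinM.
by congr EFin; ring.
Qed.

End derivative_on_segments.

(** * Existence of the zero-biased law *)

Section zero_bias_existence.
Context (R : realType) (d : measure_display) (T : measurableType d).
Context (P : probability T R) (W : {RV P >-> R}) (sigma : R).
Hypothesis sigma_gt0 : 0 < sigma.
Hypothesis mean_W : ('E_P[W] = 0)%E.
Hypothesis var_W : ('V_P[W] = (sigma ^+ 2)%:E)%E.
Notation mu := (@lebesgue_measure R).

(** As the mean is zero, so is the real number around which the variance is
    taken. *)
Lemma second_moment : (\int[P]_t (W t ^+ 2)%:E = (sigma ^+ 2)%:E)%E.
Proof.
rewrite -var_W /variance covariance.unlock mean_W /= expectation.unlock.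
by apply: eq_integral => t _; rewrite /GRing.mul/= subr0 expr2.
Qed.

Lemma integrable_sqr : P.-integrable setT (fun t => (W t ^+ 2)%:E).
Proof.
apply/integrableP; split.
  by apply/measurable_EFinP; apply: measurable_funX.
under eq_integral => t _ do rewrite gee0_abs ?lee_fin ?sqr_ge0//.
by rewrite second_moment ltry.
Qed.

Lemma integrable_RV : P.-integrable setT (EFin \o W).
Proof.
apply: (@le_integrable _ _ R P setT measurableT _ (fun t => 1 + (W t ^+ 2)%:E)%E).
- exact/measurable_EFinP.
- move=> t _; rewrite /= lee_fin [leRHS]ger0_norm ?addr_ge0 ?sqr_ge0//.
  rewrite -(real_normK (num_real (W t))); set x := `|W t|.
  have x0 : 0 <= x by exact: normr_ge0.
  nra.
- apply: integrableD => //; last exact: integrable_sqr.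
  exact: (finite_measure_integrable_cst P 1).
Qed.

(** The first coordinate selects a segment from 0 to W, the second one a point on
    it; the weight is W^2 / sigma^2 times the uniform density on the unit interval. *)
Definition segment_point (p : T * measurableTypeR R) : R := p.2 * W p.1.
Definition segment_weight (p : T * measurableTypeR R) : R :=
  (sigma ^+ 2)^-1 * W p.1 ^+ 2 * \1_(`[0, 1]) p.2.

Lemma measurable_segment_point : measurable_fun setT segment_point.
Proof.
apply: measurable_funM; first exact: measurable_snd.
by apply: measurableT_comp => //; exact: measurable_fst.
Qed.

Let measurable_indic01 :
  measurable_fun [set: measurableTypeR R] (\1_(`[0, 1]) : measurableTypeR R -> R).
Proof. by apply: measurable_indic; exact: measurable_itv. Qed.

Lemma measurable_segment_weight : measurable_fun setT segment_weight.
Proof.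
apply: measurable_funM.
  apply: measurable_funM => //; apply: measurable_funX.
  by apply: measurableT_comp => //; exact: measurable_fst.
apply: measurableT_comp; last exact: measurable_snd.
exact: measurable_indic01.
Qed.

Lemma segment_weight_ge0 p : 0 <= segment_weight p.
Proof. by rewrite /segment_weight mulr_ge0// mulr_ge0// ?invr_ge0 sqr_ge0. Qed.

Lemma integral_segment_weight :
  (\int[P \x mu]_p (segment_weight p)%:E = 1)%E.
Proof.
have mu01 : mu `[0%R, 1%R] = 1%E.
  by rewrite lebesgue_measure_itv/= lte_fin ltr01 -EFinB subr0.
rewrite fubini_tonelli1; first last.
- by move=> p; rewrite lee_fin segment_weight_ge0.
- by apply/measurable_EFinP; exact: measurable_segment_weight.
transitivity (\int[P]_t ((sigma ^+ 2)^-1%:E * (W t ^+ 2)%:E))%E.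
  apply: eq_integral => t _; rewrite /fubini_F /segment_weight /=.
  under eq_integral do rewrite EFinM.
  rewrite ge0_integralZl//; first last.
  - by rewrite lee_fin mulr_ge0 ?invr_ge0 ?sqr_ge0.
  - by apply/measurable_EFinP; exact: measurable_indic01.
  rewrite integral_indic//.
  by rewrite setIT [X in (_ * X)%E](_ : _ = 1%E) ?mule1 ?EFinM//; exact: mu01.
rewrite integralZl//; last exact: integrable_sqr.
by rewrite second_moment -EFinM mulVf// gt_eqF// exprn_gt0.
Qed.

Definition zero_biased : probability R R :=
  weighted_law measurable_segment_point measurable_segment_weight
    segment_weight_ge0 integral_segment_weight.

(** Fubini's theorem for the density times f'.  For almost every t it makes the
    inner integral meaningful, hence equal to W (f(W) - f(0)) / sigma^2. *)
Lemma integral_zero_biased_derive1 (f : R -> R) :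
  (forall x, derivable f x 1) ->
  zero_biased.-integrable setT (EFin \o f^`()%classic) ->
  P.-integrable setT (fun t => (W t * f (W t))%:E) ->
  (\int[zero_biased]_x (f^`()%classic x)%:E =
    (sigma ^+ 2)^-1%:E * \int[P]_t (W t * f (W t))%:E)%E.
Proof.
move=> df idf iWf.
have mdf := measurable_derive1 f df.
pose h (p : T * measurableTypeR R) :=
  (f^`()%classic (segment_point p) * segment_weight p)%:E.
have mh : measurable_fun setT h.
  apply/measurable_EFinP; apply: measurable_funM; last exact: measurable_segment_weight.
  exact: measurableT_comp mdf measurable_segment_point.
have ih : (P \x mu)%E.-integrable setT h.
  apply/integrableP; split=> //.
  move/integrableP : idf => [_]; rewrite ge0_integral_weighted_law//; last first.
    by apply: measurableT_comp => //; exact/measurable_EFinP.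
  congr (_ < _)%E; apply: eq_integral => p _.
  by rewrite /h /= normrM [X in _ * X]ger0_norm ?segment_weight_ge0.
transitivity (\int[P \x mu]_p h p)%E.
  by rewrite integral_weighted_law//; exact/measurable_EFinP.
rewrite -integral12_prod_meas1//.
have s0 : (sigma ^+ 2)^-1 != 0 by rewrite invr_eq0 expf_neq0// gt_eqF.
transitivity (\int[P]_t ((sigma ^+ 2)^-1 * (W t * (f (W t) - f 0)))%:E)%E.
  apply: ae_eq_integral => //.
  - exact: measurable_fubini_F ih.
  - apply/measurable_EFinP; apply: measurable_funM => //; apply: measurable_funM => //.
    apply: measurable_funB => //; apply: measurableT_comp => //.
    exact: derivable_measurable.
  - have := ae_integrable1 ih; apply: filterS => t it _.
    exact: (integral_derive1_dilation_unit_interval f (W t) _ s0 df it).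
(* The term f(0) disappears because W is centered. *)
have iW0 : P.-integrable setT (fun t => (W t * f 0)%:E).
  by apply: (@eq_integrable _ _ _ _ _ measurableT _ _ _
    (integrableZr measurableT (f 0) integrable_RV)).
have -> : (\int[P]_t (W t * f (W t))%:E =
    \int[P]_t ((W t * f (W t))%:E - (W t * f 0)%:E))%E.
  rewrite integralB//.
  have -> : (\int[P]_t (W t * f 0)%:E = 0)%E.
    under eq_integral do rewrite EFinM.
    rewrite integralZr//; last exact: integrable_RV.
    by move: mean_W; rewrite expectation.unlock => ->; rewrite mul0e.
  by rewrite sube0.
rewrite -integralZl//; last exact: integrableB.
by apply: eq_integral => t _; rewrite EFinM mulrBr EFinB.
Qed.

(** The expectation over any variable with law [zero_biased] is an integral
    against [zero_biased] itself. *)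
Lemma zero_biased_law : zero_bias_law W sigma zero_biased.
Proof.
move=> d' T' P' Wstar same f df.
move=> /Lfun1_integrable iWf /Lfun1_integrable idf.
have mdf := measurable_derive1 f df.
have mEdf : measurable_fun setT (EFin \o f^`()%classic) by exact/measurable_EFinP.
have mabs : measurable_fun setT (abse \o (EFin \o f^`()%classic)).
  exact: measurableT_comp.
have idf' : zero_biased.-integrable setT (EFin \o f^`()%classic).
  apply/integrableP; split; first exact/measurable_EFinP.
  move/integrableP : idf => [_]; congr (_ < _)%E.
  rewrite -(@ge0_integral_distribution _ _ _ _ _ P' Wstar _ mabs (fun y => abse_ge0 _)).
  by apply: eq_measure_integral => A mA _; exact: same.
rewrite !expectation.unlock.
rewrite -(@integral_distribution _ _ _ _ _ P' Wstar _ mEdf)//.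
rewrite (eq_measure_integral zero_biased); last by move=> A mA _; exact: same.
rewrite integral_zero_biased_derive1// muleA -EFinM divff ?mul1e//.
by rewrite expf_neq0// gt_eqF.
Qed.

End zero_bias_existence.

(** * Smooth approximations of rays *)

Section softplus.
Context {R : realType}.
Implicit Types x y k c : R.

Definition sigmoid y : R := (1 + expR (- y))^-1.
Definition softplus y : R := ln (1 + expR y).

Let expR1_gt0 y : 0 < 1 + expR y. Proof. by rewrite ltr_wpDl// expR_gt0. Qed.

Lemma sigmoid_gt0 y : 0 < sigmoid y. Proof. by rewrite invr_gt0. Qed.

Lemma sigmoid_sym y : 1 - sigmoid y = sigmoid (- y).
Proof.
rewrite /sigmoid opprK expRN; have e0 := expR_gt0 y; field.
by rewrite !gt_eqF//= addrC.
Qed.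

Lemma sigmoid_le1 y : sigmoid y <= 1.
Proof. by rewrite -subr_ge0 sigmoid_sym ltW// sigmoid_gt0. Qed.

Lemma sigmoid_le_harmonic y (n : nat) : y <= - n.+1%:R -> sigmoid y <= n.+1%:R^-1.
Proof.
move=> yn; rewrite lef_pV2 ?posrE//.
by have := expR_ge1Dx (- y); lra.
Qed.

Lemma is_derive_softplus y : is_derive y 1 softplus (sigmoid y).
Proof.
have -> : sigmoid y = (1 + expR y)^-1 * expR y.
  rewrite /sigmoid expRN; have e0 := expR_gt0 y; field.
  by rewrite !gt_eqF//= addrC.
apply: (@is_derive1_comp _ (@ln R) (fun y => 1 + expR y)).
  exact: is_derive1_ln.
have := @is_deriveD R R R (cst (1 : R)) expR y 1 0 (expR y)
  (is_derive_cst _ _ _) (is_derive_expR y).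
by rewrite add0r.
Qed.

Lemma softplus_bound y : `|softplus y| <= 1 + `|y|.
Proof.
rewrite ger0_norm; last by rewrite ln_ge0// lerDl ltW// expR_gt0.
rewrite -[leRHS]expRK ler_ln ?posrE ?expR_gt0// expRD.
have e1 : 2 <= expR 1 :> R by apply: le_trans (expR_ge1Dx _); rewrite -[2]/(1 + 1).
have ey : expR y <= expR `|y| by rewrite ler_expR ler_norm.
have e0 : 1 <= expR `|y| by rewrite -expR0 ler_expR.
nra.
Qed.

Lemma is_derive_softplus_affine k c x : k != 0 ->
  is_derive x 1 (fun x => k^-1 * softplus (k * x - c)) (sigmoid (k * x - c)).
Proof.
move=> k0.
have dkc : is_derive x 1 (fun x => k * x - c) k.
  have := @is_deriveD R R R (k \*: id) (cst (- c)) x 1 _ _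
    (is_deriveZ k (is_derive_id x (1 : R))) (is_derive_cst _ _ _).
  by rewrite addr0 [k *: 1]mulr1.
have := is_deriveZ k^-1 (@is_derive1_comp _ softplus (fun x => k * x - c) x _ _
  (is_derive_softplus _) dkc).
by rewrite /GRing.scale/= mulrC mulfK.
Qed.

Lemma softplus_affine_bound k c x : 0 < k ->
  `|k^-1 * softplus (k * x - c)| <= (1 + k^-1 * (1 + `|c|)) * (1 + `|x|).
Proof.
move=> k0; rewrite normrM gtr0_norm ?invr_gt0//.
rewrite -(ler_pM2l k0) mulrA divff ?gt_eqF// mul1r.
apply: le_trans (softplus_bound _) _.
apply: (@le_trans _ _ (1 + (k * `|x| + `|c|))).
  by rewrite lerD2l; apply: le_trans (ler_normB _ _) _; rewrite normrM gtr0_norm.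
rewrite [leRHS](_ : _ = (k + (1 + `|c|)) * (1 + `|x|)); last first.
  by field; rewrite gt_eqF.
have := normr_ge0 x; have := normr_ge0 c; nra.
Qed.

(** The slope (n+1)^2 outgrows the shift n+1, so the argument tends to +oo for
    x > a; the shift makes it at most -(n+1) for x <= a, so that the limit at the
    threshold a itself is 0. *)
Lemma sigmoid_cvg_indic (a x : R) :
  sigmoid (n.+1%:R ^+ 2 * x - (n.+1%:R ^+ 2 * a + n.+1%:R)) @[n --> \oo] -->
  (\1_(`]a, +oo[) x : R).
Proof.
rewrite indicE; case: (ltP a x) => ax.
  rewrite mem_set/=; last by rewrite in_itv/= ax.
  apply/cvgrPdist_le => e e0.
  have near_e : \forall n \near \oo, n.+1%:R^-1 <= e.
    have /cvgrPdist_le/(_ e e0) := @cvg_harmonic R.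
    by apply: filterS => n; rewrite sub0r normrN => /(le_trans (ler_norm _)).
  (* From this bound on, (n+1)^2 (x - a) - (n+1) is at least n+1. *)
  have near_xa : \forall n \near \oo, 2 / (x - a) <= n.+1%:R.
    apply: filterS (nbhs_infty_ger (2 / (x - a))) => n /le_trans; apply.
    by rewrite ler_nat.
  near=> n.
  rewrite sigmoid_sym ger0_norm ?(ltW (sigmoid_gt0 _))//.
  apply: (@le_trans _ _ n.+1%:R^-1); last by near: n.
  apply: sigmoid_le_harmonic.
  have : 2 / (x - a) <= n.+1%:R by near: n.
  rewrite ler_pdivrMr ?subr_gt0//.
  have : 1 <= n.+1%:R :> R by rewrite ler1n.
  nra.
rewrite memNset/=; last by rewrite in_itv/= andbT; apply/negP; rewrite -leNgt.
apply: (@squeeze_cvgr _ _ _ _ (cst 0) harmonic); [|exact: cvg_cst|exact: cvg_harmonic].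
apply: nearW => n; rewrite (ltW (sigmoid_gt0 _))/=; apply: sigmoid_le_harmonic.
have : 0 <= n.+1%:R ^+ 2 :> R by rewrite sqr_ge0.
nra.
Unshelve. all: by end_near. Qed.

End softplus.

(** * Uniqueness of the zero-biased law *)

Section zero_bias_uniqueness.
Context (R : realType) (d : measure_display) (T : measurableType d).
Context (P : probability T R) (W : {RV P >-> R}) (sigma : R).
Hypothesis sigma_gt0 : 0 < sigma.
Hypothesis mean_W : ('E_P[W] = 0)%E.
Hypothesis var_W : ('V_P[W] = (sigma ^+ 2)%:E)%E.

(** A copy of the identity that can be given its structure of random variable;
    its law under a probability is that probability. *)
Let idR : R -> R := idfun.

#[local] HB.instance Definition _ :=
  @isMeasurableFun.Build _ _ R R idR (@measurable_id _ R setT).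

(** W has a second moment, so linear growth of f makes W f(W) integrable, and f' is
    bounded; the right-hand side does not involve nu. *)
Lemma zero_bias_integral (nu : probability R R) (f : R -> R) (C : R) :
  zero_bias_law W sigma nu ->
  (forall x, derivable f x 1) ->
  (forall x, `|f x| <= C * (1 + `|x|)) ->
  (forall x, `|f^`()%classic x| <= C) ->
  (\int[nu]_x (f^`()%classic x)%:E =
    (sigma ^+ 2)^-1%:E * 'E_P[(fun t => (W t * f (W t))%R)])%E.
Proof.
move=> zb df fC f'C.
have mdf := measurable_derive1 f df.
have mf := derivable_measurable f df.
have iWf : (fun t => W t * f (W t)) \in Lfun P 1.
  apply/Lfun1_integrable.
  have iW := integrable_RV _ _ _ _ _ _ mean_W var_W.
  have iW2 := integrable_sqr _ _ _ _ _ _ mean_W var_W.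
  have iD := integrableZl measurableT C
    (integrableD measurableT (integrable_norm iW) iW2).
  apply: le_integrable iD => //.
    apply/measurable_EFinP; apply: measurable_funM => //; exact: measurableT_comp.
  move=> t _ /=; rewrite lee_fin normrM; apply: le_trans (ler_norm _).
  apply: le_trans (ler_wpM2l (normr_ge0 _) (fC _)) _.
  by rewrite -(real_normK (num_real (W t))) le_eqVlt; apply/orP; left; apply/eqP; ring.
have idf : (fun x => f^`()%classic (idR x)) \in Lfun nu 1.
  apply/Lfun1_integrable; apply: measurable_bounded_integrable => //.
    by apply: le_lt_trans (probability_le1 nu measurableT) _; rewrite ltry.
  by exists C; split; [exact: num_real|move=> M CM x _; exact: le_trans (f'C _) (ltW CM)].
have := zb _ _ nu idR (fun A _ => erefl) f df iWf idf.
move=> ->; rewrite muleA -EFinM mulVf ?mul1e ?expectation.unlock//.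
by rewrite expf_neq0// gt_eqF.
Qed.

Lemma zero_bias_unique (nu1 nu2 : probability R R) :
  zero_bias_law W sigma nu1 -> zero_bias_law W sigma nu2 -> same_law nu1 nu2.
Proof.
move=> zb1 zb2.
have rays (a : R) : nu1 `]a, +oo[%classic = nu2 `]a, +oo[%classic.
  pose k (n : nat) : R := n.+1%:R ^+ 2.
  pose c (n : nat) : R := k n * a + n.+1%:R.
  pose s n x := sigmoid (k n * x - c n).
  have k0 n : 0 < k n by rewrite exprn_gt0.
  have ds n (x : R) :
      is_derive x 1 (fun x : R => (k n)^-1 * softplus (k n * x - c n)) (s n x).
    by apply: is_derive_softplus_affine; rewrite gt_eqF.
  have fs n : (fun x : R => (k n)^-1 * softplus (k n * x - c n))^`()%classic = s n.
    by apply/funext => x; rewrite derive1E; exact: derive_val.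
  have ms n : measurable_fun setT (s n).
    by rewrite -fs; apply: measurable_derive1 => x; have [] := ds n x.
  have s_eq n : (\int[nu1]_x (s n x)%:E = \int[nu2]_x (s n x)%:E)%E.
    pose C := 1 + (k n)^-1 * (1 + `|c n|).
    have C1 : 1 <= C by rewrite lerDl mulr_ge0 ?invr_ge0 ?(ltW (k0 _))// addr_ge0.
    pose f (x : R) := (k n)^-1 * softplus (k n * x - c n).
    have df x : derivable f x 1 by have [] := ds n x.
    have fC x : `|f x| <= C * (1 + `|x|) by exact: softplus_affine_bound.
    have f'C x : `|f^`()%classic x| <= C.
      rewrite fs ger0_norm; first exact: le_trans (sigmoid_le1 _) C1.
      exact: ltW (sigmoid_gt0 _).
    rewrite -fs (zero_bias_integral nu1 f C)//.
    by rewrite (zero_bias_integral nu2 f C).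
  have cvs (nu : probability R R) :
      (\int[nu]_x (s n x)%:E)%E @[n --> \oo] --> nu `]a, +oo[%classic.
    have -> : nu `]a, +oo[%classic = (\int[nu]_x (\1_(`]a, +oo[) x)%:E)%E.
      by rewrite integral_indic// setIT.
    apply: (@dominated_cvg _ _ _ nu setT measurableT _ _ (cst 1%E)) => //.
    - by move=> n; exact/measurable_EFinP.
    - move=> x _; apply: cvg_EFin; first exact: nearW.
      exact: sigmoid_cvg_indic.
    - exact: (finite_measure_integrable_cst nu 1).
    - move=> n x _; rewrite lee_fin ger0_norm ?sigmoid_le1//.
      exact: ltW (sigmoid_gt0 _).
  rewrite -(cvg_lim _ (cvs nu1))//.
  by under eq_fun do rewrite s_eq; exact: cvg_lim (cvs nu2).
move=> A mA.
apply: (measure_unique (@RGenOInfty.G R) (fun n => `]- n%:R, +oo[%classic)) => //.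
- exact: RGenOInfty.measurableE.
- move=> _ _ [x ->] [y ->]; exists (Num.max x y).
  apply/seteqP; split => z /=; rewrite !in_itv/= !andbT gt_max.
    by move=> [-> ->].
  by move=> /andP[].
- by move=> n; exists (- n%:R).
- apply/seteqP; split => // x _; exists (Num.bound `|x|) => //=.
  rewrite in_itv/= andbT ltrNl; apply: le_lt_trans (archi_boundP _) => //.
  by rewrite -normrN ler_norm.
- by move=> _ [x ->]; exact: rays.
- by move=> n; apply: le_lt_trans (probability_le1 _ _) _; rewrite ?ltry.
Qed.

End zero_bias_uniqueness.

Theorem mainTheorem1 (R : realType) (d : measure_display)
    (T : measurableType d) (P : probability T R) (W : {RV P >-> R})
    (sigma : R) (sigma_gt0 : 0 < sigma)
    (mean_W : ('E_P[W] = 0)%E)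
    (var_W : ('V_P[W] = (sigma ^+ 2)%:E)%E) :
  exists nu : probability R R,
    zero_bias_law W sigma nu /\
    (forall nu' : probability R R,
       zero_bias_law W sigma nu' -> same_law nu' nu).
Proof.
exists (zero_biased R d T P W sigma sigma_gt0 mean_W var_W).
have zb := zero_biased_law R d T P W sigma sigma_gt0 mean_W var_W.
split=> // nu' zb'.
exact: (zero_bias_unique R d T P W sigma sigma_gt0 mean_W var_W nu' _ zb' zb).
Qed.
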